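(* Let $n\ge 2$, $M, W\ge 1$ be integers, let $\xi>0$, let $\|\cdot\|$ be any norm on $\mathbb{R}^W$, let $\mathcal{C}_1=[c_1^l,c_1^u]\subset\mathbb{R}$ be a compact interval, and let $\mathbb{B}_{2:n}=[b_2^l,b_2^u]\times\dots\times[b_n^l,b_n^u]\subset\mathbb{R}^{n-1}$ be a compact axis-aligned rectangle with center $\dot{\mathbf{v}}_{2:n}=\left[\frac{b_2^l+b_2^u}{2},\dots,\frac{b_n^l+b_n^u}{2}\right]^\top$. For each $i=1,\dots,M$ let $h_i:\mathcal{C}_1\to\mathbb{R}^W$ and $g_i:\mathbb{B}_{2:n}\to\mathbb{R}^W$ be functions, and let $\mathbf{s}_i^l,\mathbf{s}_i^u\in\mathbb{R}^W$ be vectors such that $\mathbf{s}_i^l\le g_i(\mathbf{v}_{2:n})\le \mathbf{s}_i^u$ entry-wise for all $\mathbf{v}_{2:n}\in\mathbb{B}_{2:n}$. Let the upper bounding objective $v_1\mapsto f(v_1,\dot{\mathbf{v}}_{2:n})$ and the lower bounding objective $v_1\mapsto\underline{f}(v_1)$ on $\mathcal{C}_1$ be defined from these data as in the context. If $h_i$ is Lipschitz continuous on $\mathcal{C}_1$ for every $i=1,\dots,M$, then both functions $v_1\mapsto f(v_1,\dot{\mathbf{v}}_{2:n})$ and $v_1\mapsto\underline{f}(v_1)$ are Lipschitz continuous on $\mathcal{C}_1$.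
   Context: A function $\chi$ is Lipschitz continuous if there is a constant $K>0$ such that $\|\chi(\mathbf{x}_1)-\chi(\mathbf{x}_2)\|\le K\|\mathbf{x}_1-\mathbf{x}_2\|$ for all $\mathbf{x}_1,\mathbf{x}_2\in\mathrm{dom}(\chi)$. Residuals: for $v_1\in\mathcal{C}_1$ and $\mathbf{v}_{2:n}\in\mathbb{B}_{2:n}$, $r_i(v_1,\mathbf{v}_{2:n})=\|h_i(v_1)+g_i(\mathbf{v}_{2:n})\|$. Entries are written $h_i=[h_i^{(1)},\dots,h_i^{(W)}]^\top$, $\mathbf{s}_i^l=[s_i^{(1)l},\dots,s_i^{(W)l}]^\top$, $\mathbf{s}_i^u=[s_i^{(1)u},\dots,s_i^{(W)u}]^\top$. Upper bounding objective (the objective minimized over $v_1\in\mathcal{C}_1$ to obtain an upper bound): $$f(v_1,\dot{\mathbf{v}}_{2:n})=\sum_{i=1}^M\min\{r_i(v_1,\dot{\mathbf{v}}_{2:n}),\ \xi\}.$$ Lower bounding objective (the objective minimized over $v_1\in\mathcal{C}_1$ to obtain a lower bound): $$\underline{f}(v_1)=\sum_{i=1}^M\min\{\underline{r}_i(v_1),\ \xi\},\qquad \underline{r}_i(v_1)=\left\|\left[\underline{r}_i^{(1)}(v_1),\dots,\underline{r}_i^{(W)}(v_1)\right]^\top\right\|,$$ where for $j=1,\dots,W$ $$\underline{r}_i^{(j)}(v_1)=\begin{cases} h_i^{(j)}(v_1)+s_i^{(j)l} & \text{if } h_i^{(j)}(v_1)+s_i^{(j)l}\ge 0,\\ -h_i^{(j)}(v_1)-s_i^{(j)u}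 & \text{if } h_i^{(j)}(v_1)+s_i^{(j)u}\le 0,\\ 0 & \text{otherwise.}\end{cases}$$ *)

(* Defs.v *)
From HB Require Import structures.
From mathcomp Require Export all_boot all_order all_algebra.
From mathcomp Require Export all_classical all_reals all_analysis.
Export Order.TTheory GRing.Theory Num.Theory.
Export numFieldNormedType.Exports.
Set Implicit Arguments.
Unset Strict Implicit.
Unset Printing Implicit Defensive.
Local Open Scope classical_set_scope.
Local Open Scope ring_scope.

(* The norm that the library attaches to 'rV[R]_W is the sup norm.  An
   arbitrary norm on R^W is therefore a function N satisfying the norm axioms
   (nonnegativity follows from them). *)
Record is_norm (R : realType) (V : lmodType R) (N : V -> R) : Prop := IsNorm {
  is_norm_triangle : forall x y : V, N (x + y) <= N x + N y;
  is_norm_homogeneous : forall (a : R) (x : V), N (a *: x) = `|a| * N x;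
  is_norm_definite : forall x : V, N x = 0 -> x = 0
}.

(* Lipschitz continuity on A of a function of one real variable, the codomain
   being measured by N; functions with domain A are represented by total
   functions, of which only the values on A are used. *)
Definition lipschitz_wrt (R : realType) (V : zmodType) (N : V -> R)
    (A : set R) (chi : R -> V) : Prop :=
  exists2 K : R, 0 < K &
    forall x1 x2 : R, A x1 -> A x2 -> N (chi x1 - chi x2) <= K * `|x1 - x2|.

Lemma lipschitz_wrt_normP (R : realType) (V : normedModType R)
    (A : set R) (chi : R -> V) :
  lipschitz_wrt Num.norm A chi <->
  lipschitz_on (chi : R^o -> V) (globally (A `*` A)).
Proof.
split=> [[K K0 chiK]|[M [_ HM]]].
  exists K; split; first exact: gtr0_real.
  move=> k Kk [x1 x2] [/= Ax1 Ax2]; apply: le_trans (chiK _ _ Ax1 Ax2) _.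
  by rewrite ler_wpM2r // ltW.
exists (`|M| + 1) => [|x1 x2 Ax1 Ax2]; first by rewrite ltr_pwDr.
have MK : M < `|M| + 1 by rewrite (le_lt_trans (ler_norm _)) // ltrDl.
exact: (HM _ MK (x1, x2) (conj Ax1 Ax2)).
Qed.

Definition vec_le (R : realType) (d : nat) (x y : 'rV[R]_d) : Prop :=
  forall j, x 0 j <= y 0 j.

(* For the variables v_2, ..., v_n the dimension d is n.-1, and the coordinate
   j : 'I_(n.-1) is the one of v_(j+2). *)
Definition box (R : realType) (d : nat) (bl bu : 'rV[R]_d) : set 'rV[R]_d :=
  [set v | vec_le bl v /\ vec_le v bu].

Definition box_center (R : realType) (d : nat) (bl bu : 'rV[R]_d) : 'rV[R]_d :=
  \row_j ((bl 0 j + bu 0 j) / 2).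

Definition residual (R : realType) (d W : nat) (N : 'rV[R]_W -> R)
    (hi : R -> 'rV[R]_W) (gi : 'rV[R]_d -> 'rV[R]_W)
    (v1 : R) (v : 'rV[R]_d) : R :=
  N (hi v1 + gi v).

Definition upper_objective (R : realType) (d M W : nat) (N : 'rV[R]_W -> R)
    (xi : R) (h : 'I_M -> R -> 'rV[R]_W) (g : 'I_M -> 'rV[R]_d -> 'rV[R]_W)
    (v1 : R) (v : 'rV[R]_d) : R :=
  \sum_(i < M) Num.min (residual N (h i) (g i) v1 v) xi.

(* When sl <= su the first two cases overlap only where both values are 0. *)
Definition lower_residual_entry (R : realType) (hij slj suj : R) : R :=
  if 0 <= hij + slj then hij + slj
  else if hij + suj <= 0 then - hij - suj
  else 0.

Definition lower_residual (R : realType) (W : nat) (N : 'rV[R]_W -> R)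
    (hi : R -> 'rV[R]_W) (sli sui : 'rV[R]_W) (v1 : R) : R :=
  N (\row_j lower_residual_entry (hi v1 0 j) (sli 0 j) (sui 0 j)).

Definition lower_objective (R : realType) (M W : nat) (N : 'rV[R]_W -> R)
    (xi : R) (h : 'I_M -> R -> 'rV[R]_W) (sl su : 'I_M -> 'rV[R]_W)
    (v1 : R) : R :=
  \sum_(i < M) Num.min (lower_residual N (h i) (sl i) (su i) v1) xi.

(* Main.v *)
(* Truncation at xi, N itself and each entry of the lower residual (as a function
   of h_i^(j), once s^l <= s^u, which holds since the box is nonempty) are
   1-Lipschitz.  N need not be monotone in the entries, so passing from entries
   to N and back in the lower residual uses the equivalence of N with the sup
   norm. *)
Require Import Defs.
From mathcomp Require Import lra.
Set Implicit Arguments.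
Unset Strict Implicit.
Local Open Scope classical_set_scope.
Local Open Scope ring_scope.

Lemma is_norm_sub (R : realType) (V : lmodType R) (N : V -> R) :
  is_norm N -> forall x y, N (x - y) = N (y - x).
Proof.
move=> NN x y.
by rewrite -(opprB y) -(scaleN1r (y - x)) (is_norm_homogeneous NN)
  normrN1 mul1r.
Qed.

(** The triangle inequality at [x] and [- x] yields [0 = N 0 <= 2 * N x]. *)
Lemma is_norm_ge0 (R : realType) (V : lmodType R) (N : V -> R) :
  is_norm N -> forall x, 0 <= N x.
Proof.
move=> NN x; have N0 : N 0 = 0.
  by rewrite -(scale0r 0) (is_norm_homogeneous NN) normr0 mul0r.
have := is_norm_triangle NN x (0 - x).
by rewrite addrC subrK N0 is_norm_sub// subr0; lra.
Qed.

Lemma is_norm_dist (R : realType) (V : lmodType R) (N : V -> R) :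
  is_norm N -> forall x y, `|N x - N y| <= N (x - y).
Proof.
move=> NN x y; rewrite ler_norml.
have := is_norm_triangle NN (x - y) y; have := is_norm_triangle NN (y - x) x.
by rewrite !subrK (is_norm_sub NN y); lra.
Qed.

Lemma is_norm_sum (R : realType) (V : lmodType R) (N : V -> R) (I : finType)
    (F : I -> V) :
  is_norm N -> N (\sum_i F i) <= \sum_i N (F i).
Proof.
move=> NN; elim/big_rec2: _ => [|i y x _ yx].
  by rewrite -(scale0r 0) (is_norm_homogeneous NN) normr0 mul0r.
by rewrite (le_trans (is_norm_triangle NN _ _))// lerD2l.
Qed.

Lemma normr_coord_le (R : realType) (W : nat) (x : 'rV[R]_W) j :
  `|x 0 j| <= `|x|.
Proof.
rewrite [leRHS]/Num.Def.normr /= mx_normrE.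
by apply/bigmax_geP; right => /=; exists (0, j).
Qed.

Lemma is_norm_le_sup (R : realType) (W : nat) (N : 'rV[R]_W -> R) :
  is_norm N -> exists2 C, 0 < C & forall x, N x <= C * `|x|.
Proof.
(* Expanding [x] in the standard basis bounds [N x] by the sum of the [N (delta_mx 0 j)] times the
   sup norm. The extra 1 makes the constant positive even when [W = 0]. *)
move=> NN; exists (1 + \sum_j N (delta_mx 0 j)).
  by rewrite ltr_pwDl// sumr_ge0// => j _; exact: is_norm_ge0.
move=> x; rewrite {1}(row_sum_delta x) (le_trans (is_norm_sum _ NN))//.
rewrite mulrDl mul1r mulr_suml ler_wpDl// ler_sum// => j _.
rewrite (is_norm_homogeneous NN) mulrC ler_wpM2l ?is_norm_ge0//.
exact: normr_coord_le.
Qed.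

(** By the reverse triangle inequality and [is_norm_le_sup], [N] is Lipschitz for the sup norm. *)
Lemma is_norm_continuous (R : realType) (W : nat) (N : 'rV[R]_W -> R) :
  is_norm N -> continuous N.
Proof.
move=> NN x; have [C C0 NC] := is_norm_le_sup NN.
apply/(@cvgrPdist_le _ R^o _ (nbhs x)) => e e0; near=> y.
rewrite (le_trans (is_norm_dist NN _ _))// (le_trans (NC _))//.
rewrite -ler_pdivlMl//; near: y; apply: cvgr_dist_le; first exact: cvg_id.
by rewrite mulr_gt0// invr_gt0.
Unshelve. all: by end_near. Qed.

(* N is continuous, so it attains a positive minimum on the compact sup-norm
   unit sphere. *)
Lemma sup_le_is_norm (R : realType) (W : nat) (N : 'rV[R]_W -> R) :
  is_norm N -> exists2 C, 0 < C & forall x, `|x| <= C * N x.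
Proof.
move=> NN; pose S := [set x : 'rV[R]_W | `|x| = 1].
have scaleS x : x != 0 -> S (`|x|^-1 *: x).
  move=> x0; rewrite /S/= normrZ normfV normr_id mulVf//.
  by rewrite normr_eq0.
(* The sphere is empty only when every vector is 0, as for [W = 0]; any positive constant then
   works. *)
have [[x Sx]|S0] := pselect (S !=set0); last first.
  exists 1 => // x; have [->|x0] := eqVneq x 0.
    by rewrite normr0 mul1r is_norm_ge0.
  by case: S0; exists (`|x|^-1 *: x); exact: scaleS.
have cS : compact S.
  apply: bounded_closed_compact.
    by exists 1; split=> // M M1 y /= ->; exact: ltW.
  rewrite (_ : S = (fun x => `|x|) @^-1` [set y : R | y = 1])//.
  have /continuous_closedP := @norm_continuous R 'rV[R]_W.
  by apply; exact: closed_eq.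
have cN : {within S, continuous N}.
  by apply: continuous_subspaceT; exact: is_norm_continuous.
have [c] := @EVT_min_rV _ _ N S (ex_intro _ x Sx) cS cN.
rewrite inE /S /= => c1 cmin.
have Nc : 0 < N c.
  rewrite lt0r is_norm_ge0// andbT; apply/eqP => /(is_norm_definite NN) c0.
  by move: c1; rewrite c0 normr0 => /esym/eqP; rewrite oner_eq0.
exists (N c)^-1; first by rewrite invr_gt0.
move=> y; have [->|y0] := eqVneq y 0.
  by rewrite normr0 mulr_ge0 ?invr_ge0 ?is_norm_ge0.
(* Minimality at the normalized vector gives [N c <= N y / |y|] by homogeneity. *)
have := cmin _ (mem_set (scaleS y y0)).
rewrite (is_norm_homogeneous NN) normfV normr_id ler_pdivlMl ?normr_gt0//.
by rewrite ler_pdivlMl// mulrC.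
Qed.

Lemma lipschitz_wrt_dominated (R : realType) (V1 V2 : zmodType)
    (N1 : V1 -> R) (N2 : V2 -> R) (A : set R)
    (chi : R -> V1) (psi : R -> V2) (C : R) :
    0 < C ->
    (forall x1 x2, N2 (psi x1 - psi x2) <= C * N1 (chi x1 - chi x2)) ->
  lipschitz_wrt N1 A chi -> lipschitz_wrt N2 A psi.
Proof.
move=> C0 psichi [K K0 chiK]; exists (C * K); first exact: mulr_gt0.
move=> x1 x2 Ax1 Ax2; rewrite (le_trans (psichi _ _))// -mulrA.
by rewrite ler_wpM2l ?(ltW C0) ?chiK.
Qed.

Lemma lipschitz_wrt_sum (R : realType) (I : finType) (A : set R)
    (F : I -> R -> R) :
    (forall i, lipschitz_wrt Num.norm A (F i)) ->
  lipschitz_wrt Num.norm A (fun x => \sum_i F i x).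
Proof.
move=> /(_ _)/cid2-/all_sig2[K K0 FK].
(* Lipschitz constants add up; the 1 ensures positivity when [I] is empty. *)
exists (1 + \sum_i K i).
  by rewrite ltr_pwDl// sumr_ge0// => i _; exact: ltW.
move=> x1 x2 Ax1 Ax2; rewrite -sumrB (le_trans (ler_norm_sum _ _ _))//.
rewrite mulrDl mul1r mulr_suml ler_wpDl// ler_sum// => i _.
exact: FK.
Qed.

Lemma dist_minl (R : realType) (a b c : R) :
  `|Num.min a c - Num.min b c| <= `|a - b|.
Proof.
rewrite ler_norml; have := ler_norm (a - b); have := ler_norm (b - a).
by rewrite (distrC b) !minEle; case: (leP a c); case: (leP b c); lra.
Qed.

(** For [l <= u] the entry is the distance from [- a] to the interval [[l, u]], and a distance to a
    set is 1-Lipschitz. If [u < l], it jumps at [a = - l]. *)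
Lemma dist_lower_residual_entry (R : realType) (a b l u : R) : l <= u ->
  `|lower_residual_entry a l u - lower_residual_entry b l u| <= `|a - b|.
Proof.
move=> lu; rewrite ler_norml.
have := ler_norm (a - b); have := ler_norm (b - a); rewrite (distrC b).
rewrite /lower_residual_entry.
case: (leP 0 (a + l)); case: (leP 0 (b + l));
  case: (leP (a + u) 0); case: (leP (b + u) 0); lra.
Qed.

Lemma dist_lower_residual (R : realType) (W : nat) (N : 'rV[R]_W -> R)
    (sl su : 'rV[R]_W) :
    is_norm N -> vec_le sl su ->
  exists2 C, 0 < C & forall (hi : R -> 'rV[R]_W) x1 x2,
    `|lower_residual N hi sl su x1 - lower_residual N hi sl su x2|
      <= C * N (hi x1 - hi x2).
Proof.
move=> NN slu; have [C C0 NC] := is_norm_le_sup NN.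
have [D D0 ND] := sup_le_is_norm NN.
(* [C] pays for passing from [N] to the sup norm, where the entrywise bound applies, and [D] for
   returning to [N]. *)
exists (C * D) => [|hi x1 x2]; first exact: mulr_gt0.
rewrite (le_trans (is_norm_dist NN _ _))// (le_trans (NC _))// -mulrA.
rewrite ler_wpM2l ?(ltW C0)// (le_trans _ (ND _))//.
rewrite [leLHS]/Num.Def.normr /= mx_normrE bigmax_le// => -[i j] _ /=.
rewrite !mxE (le_trans (dist_lower_residual_entry _ _ (slu j)))//.
by have := normr_coord_le (hi x1 - hi x2) j; rewrite !mxE.
Qed.

Unset Implicit Arguments.
Set Strict Implicit.

Theorem proposition1 (R : realType) (n M W : nat)
    (n_ge2 : (2 <= n)%N) (M_ge1 : (1 <= M)%N) (W_ge1 : (1 <= W)%N)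
    (xi : R) (xi_gt0 : 0 < xi)
    (N : 'rV[R]_W -> R) (N_norm : is_norm N)
    (c1l c1u : R) (c1_le : c1l <= c1u)
    (bl bu : 'rV[R]_(n.-1)) (b_le : vec_le bl bu)
    (h : 'I_M -> R -> 'rV[R]_W) (g : 'I_M -> 'rV[R]_(n.-1) -> 'rV[R]_W)
    (sl su : 'I_M -> 'rV[R]_W)
    (g_bounds : forall (i : 'I_M) (v : 'rV[R]_(n.-1)),
       box bl bu v -> vec_le (sl i) (g i v) /\ vec_le (g i v) (su i))
    (h_lip : forall i : 'I_M, lipschitz_wrt N `[c1l, c1u] (h i)) :
  lipschitz_wrt Num.norm `[c1l, c1u]
    (fun v1 : R => upper_objective N xi h g v1 (box_center bl bu)) /\
  lipschitz_wrt Num.norm `[c1l, c1u]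
    (fun v1 : R => lower_objective N xi h sl su v1).
Proof.
have slu i : vec_le (sl i) (su i).
  (* The corner [bl] witnesses that the box is nonempty. *)
  have /g_bounds-/(_ i)[slg gsu] : box bl bu bl by split=> // j.
  by move=> j; exact: le_trans (slg j) (gsu j).
split; apply: lipschitz_wrt_sum => i.
  (* The value of [g i] at the center does not depend on [v1], so it cancels in the difference and
     the constant 1 suffices. *)
  apply: (lipschitz_wrt_dominated ltr01) (h_lip i) => x1 x2.
  rewrite mul1r (le_trans (dist_minl _ _ _))//.
  rewrite (le_trans (is_norm_dist N_norm _ _))//.
  by rewrite opprD addrACA subrr addr0.
have [C C0 hC] := dist_lower_residual N_norm (slu i).
apply: (lipschitz_wrt_dominated C0) (h_lip i) => x1 x2.
by rewrite (le_trans (dist_minl _ _ _)).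
Qed.
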